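(* Let $A=\mathbb{Z}[t]$, let $G$ be a group generated by $\Sigma$, and let $x\in W(A,\Gamma)$ be a non-empty cyclically $G$-reduced word. Then there is a free abelian subgroup $X$ of $\mathrm{E}(A,G)$ with countable basis $\{x_d: d\in\mathbb{N}\}$ such that $x_0=x$ (as elements of $\mathrm{E}(A,G)$). Hence, the homomorphism $$a_0+a_1t+\cdots+a_nt^n\ \mapsto\ x^{a_0}(x_1)^{a_1}\cdots(x_n)^{a_n}$$ embeds the abelian group $A$ into $\mathrm{E}(A,G)$.
   Context: Ordered group. $A=\mathbb{Z}[t]$ is the additive group of integer polynomials, ordered by $\alpha\le\beta$ iff $\alpha=\beta$ or $\beta-\alpha$ has positive leading coefficient; $\mathbb{Z}\subseteq A$ as constants, and $1$ is the least positive element. Words. $G$ is generated by $\Sigma$, where $a\ne1$ in $G$ for all $a\in\Sigma$; $\Gamma=\Sigma\cup\Sigma^{-1}\subseteq G$, $\overline a=a^{-1}$ for $a\in\Gamma$, and $\pi:\Gamma^*\to G$ is the induced monoid homomorphism. A (closed) $A$-word of length $\alpha\ge 0$ is a map $p:[1,\alpha]\to\Gamma$, where $[1,\alpha]=\{\beta\in A: 1\le\beta\le\alpha\}$; $|p|=\alpha$. $W(A,\Gamma)$ is the monoid of $A$-words under concatenation: $(p\cdot q)(\beta)=p(\beta)$ for $1\le\beta\le|p|$ and $(p\cdot q)(\beta)=q(\beta-|p|)$ for $|p|<\beta\le|p|+|q|$. The involution is $\overline p(\beta)=\overline{p(|p|+1-\beta)}$. A word is finite if $|p|\in\mathbb{N}$;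 finite words are identified with elements of $\Gamma^*$. A word $x$ is $G$-reduced if no non-empty finite factor of $x$ (a finite $f\neq1$ with $x=pfq$) equals $1$ in $G$ under $\pi$; $x$ is cyclically $G$-reduced if $x^k$ is $G$-reduced for every $k\in\mathbb{N}$. $R(A,G)$ is the set of $G$-reduced words and $R^*(A,G)$ the submonoid of $W(A,\Gamma)$ generated by $R(A,G)$. The group $\mathrm{E}(A,G)$. $\mathcal{M}(A,G)$ is the quotient monoid of $W(A,\Gamma)$ by the relations $u\,\ell\,\overline{r}\,\overline{u}=1$ for all $u\in R(A,G)$ and $\ell,r\in\Gamma^*$ with $\pi(\ell)=\pi(r)$. $\mathrm{E}(A,G)$ is the image of $R^*(A,G)$ in $\mathcal{M}(A,G)$; it is a group, and the inverse of the class of $u\in R(A,G)$ is the class of $\overline u$. *)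

(* Defs.v *)
From HB Require Import structures.
From mathcomp Require Import all_boot all_order all_algebra generic_quotient.
From mathcomp Require Import boolp classical_sets.

Set Implicit Arguments.
Unset Strict Implicit.
Unset Printing Implicit Defensive.

Import Order.TTheory GRing.Theory Num.Theory.

Local Open Scope ring_scope.
Local Open Scope classical_set_scope.
Local Open Scope quotient_scope.
Local Open Scope group_scope.

(* The order on A = Z[t]: a <= b iff a = b or b - a has positive leading
   coefficient; [seg a] is the interval [1, a]. *)
Definition leA (a b : {poly int}) : bool :=
  (a == b) || (0 < lead_coef (b - a))%R.

Definition in_seg (a b : {poly int}) : bool := leA 1%R b && leA b a.

Definition seg (a : {poly int}) : Type := {b : {poly int} | in_seg a b}.

Section OrderLemmas.
Implicit Types a b c : {poly int}.

Lemma leAE a b : leA a b = (0 <= lead_coef (b - a))%R.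
Proof. by rewrite /leA le0r lead_coef_eq0 subr_eq0 eq_sym. Qed.

Lemma leAxx a : leA a a.
Proof. by rewrite /leA eqxx. Qed.

Lemma leA_subr a b : leA a b = leA 0%R (b - a)%R.
Proof. by rewrite !leAE subr0. Qed.

Lemma leA_add0 a b : leA 0%R a -> leA 0%R b -> leA 0%R (a + b)%R.
Proof.
rewrite /leA !subr0 => /orP[/eqP<-|ha]; first by rewrite add0r.
case/orP=> [/eqP<-|hb]; first by rewrite addr0 ha orbT.
apply/orP; right; case: (ltngtP (size a) (size b)) => hs.
- by rewrite addrC lead_coefDl.
- by rewrite lead_coefDl.
suff sD : size (a + b)%R = size a.
  by rewrite lead_coefE sD coefD -lead_coefE hs -lead_coefE addr_gt0.
apply/eqP; rewrite eqn_leq (leq_trans (size_polyD a b)) ?hs ?maxnn //=.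
rewrite -hs; apply: contraTT (addr_gt0 ha hb); rewrite -ltnNge => hlt.
have : ((a + b)`_(size a).-1 = 0)%R.
  by apply: nth_default; case: (size a) hlt.
by rewrite coefD -lead_coefE hs -lead_coefE => ->; rewrite ltxx.
Qed.

Lemma leA_trans b a c : leA a b -> leA b c -> leA a c.
Proof.
rewrite leA_subr => h; rewrite leA_subr => h'; rewrite leA_subr.
by rewrite -(subrKA b) leA_add0.
Qed.

Lemma leA_add2l c a b : leA (c + a)%R (c + b)%R = leA a b.
Proof. by rewrite leA_subr [RHS]leA_subr opprD addrACA subrr add0r. Qed.

Lemma leA_sub2l c a b : leA (c - a)%R (c - b)%R = leA b a.
Proof. by rewrite leA_add2l leA_subr [RHS]leA_subr opprK addrC. Qed.

Lemma leA01 : leA 0%R 1%R.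
Proof. by rewrite leAE subr0 lead_coef1. Qed.

Lemma leA_anti a b : leA a b -> leA b a -> a = b.
Proof.
rewrite !leAE -[(a - b)%R]opprB lead_coefN oppr_ge0 => h1 h2.
by apply/esym/eqP; rewrite -subr_eq0 -lead_coef_eq0 eq_le h2.
Qed.

Lemma ltA_add1 a b : ~~ leA a b -> leA (b + 1)%R a.
Proof.
rewrite leAE -ltNge -opprB lead_coefN oppr_lt0 leA_subr opprD addrA => h.
have [->|hs] := eqVneq (a - b)%R 1%R; first by rewrite subrr leAxx.
rewrite leAE subr0; set d := (a - b)%R in h hs *.
have [s1|s1] := leqP (size d) 1.
  rewrite (size1_polyC s1) in h hs *.
  rewrite -polyCB lead_coefC subr_ge0; by rewrite lead_coefC in h.
by rewrite lead_coefDl ?ltW // size_polyN size_polyC.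
Qed.

Lemma in_segl a b c : leA 0%R b -> in_seg a c -> in_seg (a + b)%R c.
Proof.
move=> hb /andP[h1 h2]; apply/andP; split=> //; apply: leA_trans h2 _.
by rewrite -{1}[a]addr0 leA_add2l.
Qed.

Lemma in_seg_le a b c : in_seg a b -> leA b c -> in_seg c b.
Proof. by move=> /andP[h _] h'; apply/andP. Qed.

Lemma in_segr a b c : in_seg (a + b)%R c -> ~~ leA c a -> in_seg b (c - a)%R.
Proof.
move=> /andP[_ h2] /ltA_add1 h; apply/andP; split.
  by rewrite -(leA_add2l a) subrKC.
by rewrite -(leA_add2l a) subrKC.
Qed.

Lemma in_seg_rev a b : in_seg a b -> in_seg a (a + 1 - b)%R.
Proof.
move=> /andP[h1 h2]; apply/andP; split.
  by rewrite -(leA_sub2l (a + 1)%R) opprB addrC subrK addrK.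
by rewrite -{2}[a](addrK 1%R) leA_sub2l.
Qed.

Lemma in_seg0 b : in_seg 0%R b = false.
Proof.
apply/negP=> /andP[h1 h2]; have := leA_anti leA01 (leA_trans h1 h2).
by move/eqP; rewrite eq_sym oner_eq0.
Qed.

End OrderLemmas.

Section Groups.
Variable H : groupType.

Definition subgroup (X : set H) : Prop :=
  [/\ X 1, (forall a b, X a -> X b -> X (a * b)) & forall a, X a -> X a^-1].

(* Integer powers: [Negz n] is -(n+1). *)
Definition expgz (a : H) (z : int) : H :=
  match z with Posz n => a ^+ n | Negz n => a ^- n.+1 end.

(* X is a commutative subgroup, generated by the family xs, which is
   Z-linearly independent. *)
Definition free_abelian_basis (X : set H) (xs : nat -> H) : Prop :=
  [/\ subgroup X,
      (forall a b, X a -> X b -> a * b = b * a),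
      smallest subgroup (range xs) = X
    & forall (n : nat) (c : nat -> int),
        \prod_(i < n) expgz (xs i) (c i) = 1 ->
        forall i, (i < n)%N -> c i = 0%R].

Definition poly_hom (xs : nat -> H) (a : {poly int}) : H :=
  \prod_(i < size a) expgz (xs i) (a`_i)%R.

End Groups.

Section Words.
Variables (G : groupType) (Sigma : set G).

Definition in_Gamma (a : G) : bool := `[< Sigma a \/ Sigma a^-1 >].

Definition Gamma : Type := {a : G | in_Gamma a}.

Lemma in_GammaV a : in_Gamma a -> in_Gamma a^-1.
Proof. by move=> /asboolP[h|h]; apply/asboolP; [right; rewrite invgK|left]. Qed.

Definition barG (a : Gamma) : Gamma := exist _ (sval a)^-1 (in_GammaV (svalP a)).

Lemma barGK : involutive barG.
Proof. by move=> a; apply/val_inj; rewrite /= invgK. Qed.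

Record word : Type := Word {
  wlen : {poly int};
  wlen_ge0 : leA 0%R wlen;
  wat : seg wlen -> Gamma
}.

HB.instance Definition _ := gen_eqMixin word.
HB.instance Definition _ := gen_choiceMixin word.

Lemma word_ext (p q : word) : wlen p = wlen q ->
  (forall b (hp : in_seg (wlen p) b) (hq : in_seg (wlen q) b),
     wat (exist _ b hp) = wat (exist _ b hq)) -> p = q.
Proof.
case: p q => [a ha f] [a' ha' f'] /= e; rewrite -{}e in ha' f' * => hf.
have -> : f = f' by apply: funext => -[b hb]; apply: hf.
by congr Word; apply: bool_irrelevance.
Qed.

Lemma wat_irr (p : word) b b' (h : in_seg (wlen p) b) (h' : in_seg (wlen p) b') :
  b = b' -> wat (exist _ b h) = wat (exist _ b' h').
Proof. by move=> e; congr wat; apply/val_inj. Qed.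

Definition wcat_at (p q : word) (b : seg (wlen p + wlen q)%R) : Gamma :=
  match decP (@idP (leA (sval b) (wlen p))) with
  | left h =>
      wat (exist (in_seg (wlen p)) (sval b) (in_seg_le (svalP b) h))
  | right h =>
      wat (exist (in_seg (wlen q)) (sval b - wlen p)%R
             (in_segr (svalP b) (introN idP h)))
  end.

Definition wcat (p q : word) : word :=
  Word (leA_add0 (wlen_ge0 p) (wlen_ge0 q)) (@wcat_at p q).

Definition wnil : word :=
  Word (leAxx 0%R) (fun b => False_rect Gamma (notF (etrans (esym (in_seg0 (sval b))) (svalP b)))).

Definition wbar (p : word) : word :=
  Word (wlen_ge0 p)
    (fun b => barG (wat (exist (in_seg (wlen p)) (wlen p + 1 - sval b)%R
                           (in_seg_rev (svalP b))))).

Lemma wat_catl p q b (h : in_seg (wlen (wcat p q)) b) (h' : in_seg (wlen p) b) :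
  wat (exist _ b h) = wat (exist _ b h').
Proof.
rewrite /wcat /= /wcat_at /=; case: decP => h1; first exact: wat_irr.
by case: h1; case/andP: h'.
Qed.

Lemma wat_catr p q b (h : in_seg (wlen (wcat p q)) b)
    (h' : in_seg (wlen q) (b - wlen p)%R) :
  wat (exist _ b h) = wat (exist _ (b - wlen p)%R h').
Proof.
rewrite /wcat /= /wcat_at /=; case: decP => h1; last exact: wat_irr.
have /andP[h2 _] := h'; have : leA (b - wlen p)%R 0%R.
  by rewrite -(leA_add2l (wlen p)) subrKC addr0.
by move/(leA_trans h2)/(leA_anti leA01)/eqP; rewrite eq_sym oner_eq0.
Qed.

Lemma wcatA : associative wcat.
Proof.
move=> p q r; apply: word_ext; first exact: addrA.
move=> b h1 h2; have [h|h] := boolP (leA b (wlen p)).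
  have hb : in_seg (wlen p) b := in_seg_le h1 h.
  have hpq : in_seg (wlen (wcat p q)) b by apply: in_segl => //; apply: wlen_ge0.
  by rewrite (wat_catl _ hb) (wat_catl _ hpq) (wat_catl _ hb).
have hqr := in_segr h1 h; rewrite (wat_catr _ hqr).
have [h'|h'] := boolP (leA b (wlen (wcat p q))).
  have hpq : in_seg (wlen (wcat p q)) b := in_seg_le h1 h'.
  have hq := in_segr hpq h.
  by rewrite (wat_catl _ hpq) (wat_catr _ hq) (wat_catl _ hq).
have hr := in_segr h2 h'; rewrite (wat_catr _ hr).
have hr' : in_seg (wlen r) (b - wlen p - wlen q)%R.
  by move: hr; rewrite /= opprD addrA.
by rewrite (wat_catr _ hr'); apply: wat_irr; rewrite /= opprD addrA.
Qed.

Lemma wcat1w : left_id wnil wcat.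
Proof.
move=> p; apply: word_ext; first exact: add0r.
move=> b h1 h2; have h : in_seg (wlen p) (b - wlen wnil)%R by rewrite subr0.
by rewrite (wat_catr _ h); apply: wat_irr; rewrite subr0.
Qed.

Lemma wbarK : involutive wbar.
Proof.
move=> p; apply: word_ext => //= b h1 h2.
by rewrite barGK; apply: wat_irr; rewrite subKr.
Qed.

Lemma wbarM p q : wbar (wcat p q) = wcat (wbar q) (wbar p).
Proof.
apply: word_ext; first exact: addrC.
move=> b h1 h2; have [h|h] := boolP (leA b (wlen q)).
  have hb : in_seg (wlen (wbar q)) b := in_seg_le h1 h.
  rewrite (wat_catl _ hb) /=; congr barG.
  have e : (wlen p + wlen q + 1 - b - wlen p = wlen q + 1 - b)%R.
    by rewrite -!addrA addrC !addrA addrNK.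
  have hr : in_seg (wlen q) (wlen p + wlen q + 1 - b - wlen p)%R.
    by rewrite e; apply: in_seg_rev.
  by apply: etrans (wat_catr _ hr) _; apply: wat_irr.
have hb : in_seg (wlen (wbar p)) (b - wlen (wbar q))%R by apply: in_segr.
rewrite (wat_catr _ hb) /=; congr barG.
have e : (wlen p + wlen q + 1 - b = wlen p + 1 - (b - wlen q))%R.
  by rewrite opprB [RHS]addrA [(wlen p + wlen q + 1)%R]addrAC.
have hp : in_seg (wlen p) (wlen p + wlen q + 1 - b)%R.
  by rewrite e; apply: in_seg_rev.
by apply: etrans (wat_catl _ hp) _; apply: wat_irr.
Qed.

(* W(A, Gamma) is the monoid [word]; [p^-1] on words denotes the involution
   [wbar], an involutive anti-automorphism and not a monoid inverse. *)
HB.instance Definition _ := isStarMonoid.Build word wcatA wcat1w wbarK wbarM.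

Definition letter (a : Gamma) : word := Word leA01 (fun _ => a).

(* The identification of Gamma^* with the finite words. *)
Definition finword (s : seq Gamma) : word := \prod_(a <- s) letter a.

Definition piG (s : seq Gamma) : G := \prod_(a <- s) sval a.

Definition G_reduced (x : word) : Prop :=
  forall (p q : word) (f : seq Gamma),
    x = p * finword f * q -> f <> [::] -> piG f <> 1.

Definition cyclically_G_reduced (x : word) : Prop :=
  forall k : nat, G_reduced (x ^+ k).

Definition in_Rstar (w : word) : Prop :=
  exists2 s : seq word, (forall u, u \in s -> G_reduced u) & w = \prod_(u <- s) u.

(* The least monoid congruence containing u l (bar r) (bar u) = 1. *)
Inductive Mcong : word -> word -> Prop :=
| Mcong_rel (u : word) (l r : seq Gamma) :
    G_reduced u -> piG l = piG r ->
    Mcong (u * finword l * (finword r)^-1 * u^-1) 1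
| Mcong_refl u : Mcong u u
| Mcong_sym u v : Mcong u v -> Mcong v u
| Mcong_trans u v w : Mcong u v -> Mcong v w -> Mcong u w
| Mcong_mul u u' v v' : Mcong u u' -> Mcong v v' -> Mcong (u * v) (u' * v').

Definition Mrel (u v : word) : bool := `[< Mcong u v >].

Lemma Mrel_refl : reflexive Mrel.
Proof. by move=> u; apply/asboolP/Mcong_refl. Qed.

Lemma Mrel_sym : symmetric Mrel.
Proof. by move=> u v; apply/asboolP/asboolP => /Mcong_sym. Qed.

Lemma Mrel_trans : transitive Mrel.
Proof.
by move=> v u w /asboolP h /asboolP h'; apply/asboolP/(Mcong_trans h h').
Qed.

Canonical Mequiv := EquivRel Mrel Mrel_refl Mrel_sym Mrel_trans.

Definition M : Type := {eq_quot Mequiv}.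

HB.instance Definition _ := Choice.on M.

Definition Mclass (w : word) : M := \pi_{eq_quot Mequiv} w.

Lemma MclassP u v : Mclass u = Mclass v <-> Mcong u v.
Proof. by rewrite /Mclass; split=> [/eqmodP/asboolP|h]//; apply/eqmodP/asboolP. Qed.

Definition Mrepr (m : M) : word := repr (m : {eq_quot Mequiv}).

Lemma MreprK m : Mclass (Mrepr m) = m.
Proof. exact: reprK. Qed.

Lemma Mcong_repr u : Mcong (Mrepr (Mclass u)) u.
Proof. by apply/MclassP; rewrite MreprK. Qed.

Definition Mmul (m n : M) : M := Mclass (Mrepr m * Mrepr n).
Definition Minv (m : M) : M := Mclass (Mrepr m)^-1.

Lemma Mclass_mul u v : Mclass (u * v) = Mmul (Mclass u) (Mclass v).
Proof. by apply/MclassP/Mcong_sym/Mcong_mul; apply: Mcong_repr. Qed.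

Lemma Mcong_inv u v : Mcong u v -> Mcong u^-1 v^-1.
Proof.
elim=> {u v} [u l r hu hlr|u|u v _|u v w _ h _|u u' v v' _ h _ h'].
- rewrite invg1 !invgM !invgK !mulgA; exact: Mcong_rel.
- exact: Mcong_refl.
- exact: Mcong_sym.
- exact: Mcong_trans.
- by rewrite !invgM; apply: Mcong_mul.
Qed.

Lemma Mclass_inv u : Mclass u^-1 = Minv (Mclass u).
Proof. by apply/MclassP/Mcong_sym/Mcong_inv/Mcong_repr. Qed.

Lemma MmulA : associative Mmul.
Proof.
by move=> m n k; rewrite -[m]MreprK -[n]MreprK -[k]MreprK -!Mclass_mul mulgA.
Qed.

Lemma Mmul1m : left_id (Mclass 1) Mmul.
Proof. by move=> m; rewrite -[m]MreprK -Mclass_mul mul1g. Qed.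

Lemma MinvK : involutive Minv.
Proof. by move=> m; rewrite -[m]MreprK -!Mclass_inv invgK. Qed.

Lemma MinvM m n : Minv (Mmul m n) = Mmul (Minv n) (Minv m).
Proof.
by rewrite -[m]MreprK -[n]MreprK -(Mclass_mul, Mclass_inv) -!Mclass_inv
  -Mclass_mul invgM.
Qed.

(* The involution of words descends to M(A, G); it is the group inverse on
   E(A, G), but not a monoid inverse on M(A, G). *)
HB.instance Definition _ := isStarMonoid.Build M MmulA Mmul1m MinvK MinvM.

Lemma MclassM u v : Mclass (u * v) = Mclass u * Mclass v.
Proof. exact: Mclass_mul. Qed.

Lemma MclassV u : Mclass u^-1 = (Mclass u)^-1.
Proof. exact: Mclass_inv. Qed.

Definition in_E (m : M) : bool :=
  `[< exists2 w, in_Rstar w & m = Mclass w >].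

Definition E : Type := {m : M | in_E m}.

HB.instance Definition _ := SubChoice.on E.

Lemma Rstar_mul u v : in_Rstar u -> in_Rstar v -> in_Rstar (u * v).
Proof.
move=> [s hs ->] [s' hs' ->]; exists (s ++ s'); last by rewrite big_cat.
by move=> w; rewrite mem_cat => /orP[/hs|/hs'].
Qed.

Lemma in_E_closed : monoid_closed in_E.
Proof.
split; first by apply/asboolP; exists 1 => //; exists [::] => //; rewrite big_nil.
move=> _ _ /asboolP[u hu ->] /asboolP[v hv ->]; apply/asboolP.
by exists (u * v); [apply: Rstar_mul|rewrite MclassM].
Qed.

HB.instance Definition _ := SubChoice_isSubMonoid.Build M in_E E in_E_closed.

Lemma finword1 a : finword [:: a] = letter a.
Proof. by rewrite /finword big_seq1. Qed.

Lemma finwordV f : (finword f)^-1 = finword (rev (map barG f)).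
Proof.
rewrite /finword; elim: f => [|a f IH]; first by rewrite !big_nil invg1.
by rewrite big_cons invgM IH /= rev_cons -cats1 big_cat /= big_seq1.
Qed.

Lemma piGV f : piG (rev (map barG f)) = (piG f)^-1.
Proof.
rewrite /piG; elim: f => [|a f IH]; first by rewrite !big_nil invg1.
by rewrite big_cons invgM -IH /= rev_cons -cats1 big_cat /= big_seq1.
Qed.

Lemma G_reducedV u : G_reduced u -> G_reduced u^-1.
Proof.
move=> hu p q f e f0 f1; apply: (hu q^-1 p^-1 (rev (map barG f))).
- by rewrite -[u]invgK e !invgM finwordV mulgA.
- by case: {e f1} f f0 => // a f _; rewrite /= rev_cons; case: (rev _).
- by rewrite piGV f1 invg1.
Qed.

Lemma Mclass_mulV u : in_Rstar u -> Mclass u * (Mclass u)^-1 = 1.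
Proof.
case=> s hs ->; elim: s hs => [|u' s IH] hs.
  by rewrite big_nil -MclassV -MclassM invg1 mulg1.
rewrite big_cons MclassM invgM mulgA -[_ * _ * (Mclass (\prod_(_ <- _) _))^-1]mulgA IH.
  rewrite mulg1 -MclassV -MclassM; apply/MclassP.
  have := @Mcong_rel u' [::] [::] (hs _ (mem_head _ _)) erefl.
  by rewrite /finword big_nil invg1 !mulg1.
by move=> v hv; apply: hs; rewrite inE hv orbT.
Qed.

Lemma Rstar_inv u : in_Rstar u -> in_Rstar u^-1.
Proof.
case=> s hs ->; exists (rev (map wbar s)).
  by move=> v; rewrite mem_rev => /mapP[w /hs hw ->]; apply: G_reducedV.
elim: {hs} s => [|w s IH]; first by rewrite !big_nil invg1.
by rewrite big_cons invgM IH /= rev_cons -cats1 big_cat /= big_seq1.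
Qed.

Lemma in_E_inv m : in_E m -> in_E m^-1.
Proof.
move=> /asboolP[u hu ->]; apply/asboolP; exists u^-1; first exact: Rstar_inv.
by rewrite MclassV.
Qed.

Definition Einv (m : E) : E := exist in_E (val m)^-1 (in_E_inv (valP m)).

Lemma mulEV : right_inverse 1 Einv *%g.
Proof.
move=> [m hm]; apply/val_inj; rewrite valM val1 /=.
by case/asboolP: (hm) => u hu ->; apply: Mclass_mulV.
Qed.

Lemma mulVE : left_inverse 1 Einv *%g.
Proof.
move=> m; rewrite -[X in _ * X](_ : Einv (Einv m) = m) ?mulEV //.
by apply/val_inj; rewrite /= invgK.
Qed.

HB.instance Definition _ := hasInv.Build E Einv.
HB.instance Definition _ := Monoid_isGroup.Build E mulVE mulEV.

End Words.

(* Main.v *)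
Require Import Defs.
From HB Require Import structures.
From mathcomp Require Import all_boot all_order all_algebra.
From mathcomp Require Import boolp classical_sets.

Set Implicit Arguments.
Unset Strict Implicit.
Unset Printing Implicit Defensive.

Import Order.TTheory GRing.Theory Num.Theory.

Local Open Scope ring_scope.
Local Open Scope classical_set_scope.
Local Open Scope group_scope.

(** Let al be the length of x. Writing a polynomial g as its part of degree at
    most deg al plus higher terms, the low part has a unique representative r
    in [1, al] modulo the integer multiples of al, and g |-> x(r) is a
    labelling of the whole group Z[t] which is invariant under the lattice of
    all l whose low part is an integer multiple of al. Restricting it to
    [1, l] gives, for every l >= 0 in the lattice, a word w_l, and periodicity
    says w_l w_m = w_(l + m). So the w_l commute already as words, x is
    w_al and x^k is w_(k al). Taking x_d := w_(t^(deg al + d)) for d > 0, the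
    map of the theorem is the composite of an injective additive map from Z[t]
    to the lattice with the homomorphism extending l |-> w_l to negative l.

    Every finite factor of w_l can be translated by the lattice into some
    power of x, hence w_l is G-reduced ([tab_periodic_reduced]). What remains
    is that a G-reduced word which is trivial in M(A, G) is empty
    ([reduced_Mcong1]); applied to w_l it says that the homomorphism is
    injective on the lattice.

    That fact is proved by a confluence argument. The relation [eval w g]
    says that w can be seen to represent g in G by a finite non-crossing
    cancellation: letters evaluate to themselves, values multiply, and
    u w u^-1 evaluates to 1 if w does and u is reduced. A reduced word can
    only evaluate to something when it is finite ([eval_reduced]), because a
    reduced word contains no fold s s^-1. The point is that evaluation to 1 is
    insensitive to inserting or deleting a relator anywhere ([eval_Mcong]).
    Evaluation to 1 is stable under cyclic rotation ([eval_rot]), and this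
    reduces everything to three facts: finite words can be stripped
    off the end ([eval_strip]), a trivial word can be inserted ([eval_insert]),
    and a fold u u^-1 can be deleted ([eval_cancel]); the last one needs that
    p u and u^-1 q being evaluable makes p q evaluable ([eval_join]). The
    proofs are inductions on [eval] in which the given factorization is
    compared with that of the derivation by Levi's lemma ([levi]). *)

Local Notation A := {poly int}.

(** * The order on Z[t] *)

Lemma leA_total (a b : A) : leA a b || leA b a.
Proof.
have [//|/ltA_add1 h] := boolP (leA a b).
apply: leA_trans h; rewrite -{1}[b]addr0 leA_add2l; exact: leA01.
Qed.

Lemma leA_addr (a b : A) : leA 0%R b -> leA a (a + b)%R.
Proof. by rewrite -{1}[a]addr0 leA_add2l. Qed.

Lemma leA_addl (a b : A) : leA 0%R b -> leA a (b + a)%R.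
Proof. by rewrite addrC; apply: leA_addr. Qed.

Lemma leA_subr_ge0 (a b : A) : leA a b -> leA 0%R (b - a)%R.
Proof. by rewrite leA_subr. Qed.

Lemma leA_ge1 (a : A) : leA 0%R a -> a <> 0%R -> leA 1%R a.
Proof.
move=> h ha; rewrite -[1%R]add0r; apply: ltA_add1.
by apply/negP=> h'; apply: ha; apply: leA_anti.
Qed.

Lemma leA_sum0 (a b : A) : leA 0%R a -> leA 0%R b -> (a + b = 0)%R -> a = 0%R.
Proof. by move=> ha hb e; apply: leA_anti => //; rewrite -e leA_addr. Qed.

(** A positive coefficient in the top admissible degree decides the sign, even
    though [size p] is only bounded and not known. *)
Lemma leA_gt0_coef (n : nat) (p : A) : (size p <= n.+1)%N -> (0 < p`_n)%R ->
  leA 0%R p /\ p <> 0%R.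
Proof.
move=> hs hp; have sp : size p = n.+1.
  apply/eqP; rewrite eqn_leq hs ltnNge; apply/negP=> /leq_sizeP/(_ n (leqnn n)) e.
  by rewrite e ltxx in hp.
split; last by move=> p0; rewrite p0 size_poly0 in sp.
by rewrite leAE subr0 lead_coefE sp ltW.
Qed.

Lemma leA_size (a b : A) : leA 0%R a -> leA a b -> (size a <= size b)%N.
Proof.
rewrite leAE subr0 => ha hab; rewrite leqNgt; apply/negP=> hs.
move: hab; rewrite leAE addrC lead_coefDl ?size_polyN // lead_coefN oppr_ge0 => h.
have : lead_coef a == 0%R by rewrite eq_le h.
by rewrite lead_coef_eq0 => /eqP a0; rewrite a0 size_poly0 in hs.
Qed.

Lemma leA_muln (a : A) n : leA 0%R a -> leA 0%R (a *+ n)%R.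
Proof. by move=> h; elim: n => [|n IH]; rewrite ?leAxx // mulrS leA_add0. Qed.

Lemma take_polyB n (p q : A) :
  take_poly n (p - q)%R = (take_poly n p - take_poly n q)%R.
Proof. by rewrite -scaleN1r take_polyD take_polyZ scaleN1r. Qed.

(** * Combinatorics of words *)

Section Words.
Variables (G : groupType) (Sigma : set G) (a0 : Gamma Sigma).
Local Notation Gam := (Gamma Sigma).
Local Notation W := (word Sigma).
Implicit Types (p q r s u v w n m k : W) (f : seq Gam) (F : A -> Gam).

(** Total extension of the letter map, with the arbitrary letter a0 outside
    [1, |w|]: it removes the proofs of membership from all computations with
    positions. *)
Definition wfun w (b : A) : Gam := oapp (@wat _ _ w) a0 (insub b).

Lemma wfunE w b (h : in_seg (wlen w) b) : wfun w b = wat (exist _ b h).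
Proof. by rewrite /wfun insubT. Qed.

Lemma wfun_ext p q : wlen p = wlen q ->
  (forall b, in_seg (wlen p) b -> wfun p b = wfun q b) -> p = q.
Proof.
move=> e h; apply: word_ext => // b hp hq.
by rewrite -!wfunE; apply: h.
Qed.

Lemma wlenM p q : wlen (p * q) = (wlen p + wlen q)%R.
Proof. by []. Qed.

Lemma wlen1 : wlen (1 : W) = 0%R.
Proof. by []. Qed.

Lemma wfun_catl p q b : in_seg (wlen p) b -> wfun (p * q) b = wfun p b.
Proof.
move=> h; have h' : in_seg (wlen (p * q)) b by apply: in_segl h; apply: wlen_ge0.
by rewrite (wfunE h) (wfunE h'); apply: wat_catl.
Qed.

Lemma wfun_catr p q b :
  in_seg (wlen q) b -> wfun (p * q) (wlen p + b)%R = wfun q b.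
Proof.
move=> h; have e : (wlen p + b - wlen p = b)%R by rewrite addrC addKr.
have h1 : in_seg (wlen q) (wlen p + b - wlen p)%R by rewrite e.
have h' : in_seg (wlen (p * q)) (wlen p + b)%R.
  case/andP: h => hb1 hb2; rewrite wlenM; apply/andP; split.
    by apply: (leA_trans hb1); apply: leA_addl; apply: wlen_ge0.
  by rewrite leA_add2l.
rewrite (wfunE h) (wfunE h'); apply: etrans (wat_catr h' h1) _.
exact: wat_irr.
Qed.

Definition nneg (L : A) : A := if leA 0%R L then L else 0%R.

Lemma nneg_ge0 L : leA 0%R (nneg L).
Proof. by rewrite /nneg; case: ifP => //; rewrite leAxx. Qed.

Lemma nneg_id L : leA 0%R L -> nneg L = L.
Proof. by rewrite /nneg => ->. Qed.

(** The word of length L spelled by F; the length is truncated at 0 to make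
    the construction total. *)
Definition tab F (L : A) : W := Word (nneg_ge0 L) (fun b => F (sval b)).

Lemma wlen_tab F L : leA 0%R L -> wlen (tab F L) = L.
Proof. exact: nneg_id. Qed.

Lemma wfun_tab F L b : leA 0%R L -> in_seg L b -> wfun (tab F L) b = F b.
Proof.
move=> hL hb; have h : in_seg (wlen (tab F L)) b by rewrite wlen_tab.
by rewrite (wfunE h).
Qed.

Lemma eq_tab F F' L : (forall b, in_seg L b -> F b = F' b) -> tab F L = tab F' L.
Proof.
move=> h; apply: word_ext => // b h1 h2 /=; apply: h; move: h1.
by rewrite /= /nneg; case: ifP => // _; rewrite in_seg0.
Qed.

Lemma tab_wfun w : tab (wfun w) (wlen w) = w.
Proof.
apply: wfun_ext; first by rewrite wlen_tab // wlen_ge0.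
by move=> b; rewrite wlen_tab ?wlen_ge0 // => h; rewrite wfun_tab ?wlen_ge0.
Qed.

Lemma tabl p q : p = tab (wfun (p * q)) (wlen p).
Proof. by rewrite -{1}[p]tab_wfun; apply: eq_tab => b hb; rewrite wfun_catl. Qed.

Lemma tabr p q : q = tab (fun b => wfun (p * q) (wlen p + b)%R) (wlen q).
Proof. by rewrite -{1}[q]tab_wfun; apply: eq_tab => b hb; rewrite wfun_catr. Qed.

Lemma in_seg_catP (L L' b : A) : in_seg (L + L')%R b ->
  in_seg L b \/ exists2 b', in_seg L' b' & b = (L + b')%R.
Proof.
move=> h; have [hb|hb] := boolP (leA b L); first by left; apply: in_seg_le h hb.
by right; exists (b - L)%R; [apply: in_segr|rewrite addrC subrK].
Qed.

Lemma tabD F L L' : leA 0%R L -> leA 0%R L' ->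
  tab F (L + L')%R = tab F L * tab (fun b => F (L + b)%R) L'.
Proof.
move=> h h'; have h2 := leA_add0 h h'.
apply: wfun_ext; first by rewrite wlenM !wlen_tab.
move=> b; rewrite wlen_tab // => hb; rewrite wfun_tab //.
case: (in_seg_catP hb) => [hb1|[b' hb1 ->]].
  by rewrite wfun_catl ?wlen_tab // wfun_tab.
have := @wfun_catr (tab F L) (tab (fun b => F (L + b)%R) L') b'.
by rewrite !wlen_tab // => ->; rewrite ?wfun_tab.
Qed.

Lemma mulwI p q q' : p * q = p * q' -> q = q'.
Proof.
move=> e; have el : wlen q = wlen q'.
  by have := congr1 (@wlen _ _) e; rewrite !wlenM => /addrI.
by rewrite (tabr p q) (tabr p q') e el.
Qed.

Lemma mulIw p q q' : q * p = q' * p -> q = q'.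
Proof.
move/(congr1 (fun w : W => w^-1)); rewrite !invgM => /mulwI e.
by rewrite -[q]invgK e invgK.
Qed.

(** The overlap s is read off the common word, at the positions after |p| and
    up to |p'|. *)
Lemma levi_le p q p' q' : p * q = p' * q' -> leA (wlen p) (wlen p') ->
  exists s, p' = p * s /\ q = s * q'.
Proof.
move=> e /leA_subr_ge0 h.
pose s := tab (fun b => wfun (p * q) (wlen p + b)%R) (wlen p' - wlen p)%R.
have es : p' = p * s.
  rewrite {1}(tabl p q) /s -tabD ?wlen_ge0 // [(wlen p + _)%R]addrC subrK.
  by rewrite e -tabl.
by exists s; split=> //; apply: (@mulwI p); rewrite e es mulgA.
Qed.

Lemma levi p q p' q' : p * q = p' * q' ->
  (exists s, p' = p * s /\ q = s * q') \/ (exists s, p = p' * s /\ q' = s * q).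
Proof.
move=> e; have /orP[h|h] := leA_total (wlen p) (wlen p').
  by left; apply: levi_le.
by right; apply: levi_le.
Qed.

Lemma wlen0 w : wlen w = 0%R -> w = 1.
Proof.
move=> h; apply: wfun_ext; first by rewrite h.
by move=> b; rewrite h in_seg0.
Qed.

Lemma wlenN0 w : w <> 1 -> leA 1%R (wlen w).
Proof. by move=> h; apply: leA_ge1; [apply: wlen_ge0|move/wlen0]. Qed.

(** Words have length >= 0, so that no product of nonempty words is empty. *)
Lemma mulw1 p q : p * q = 1 -> p = 1 /\ q = 1.
Proof.
move=> e; have h := congr1 (@wlen _ _) e; rewrite wlenM wlen1 in h.
split; apply: wlen0.
  by apply: (leA_sum0 (wlen_ge0 p) (wlen_ge0 q) h).
by rewrite addrC in h; apply: (leA_sum0 (wlen_ge0 q) (wlen_ge0 p) h).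
Qed.

Lemma letter_neq1 (a : Gam) : letter a <> 1.
Proof. by move/(congr1 (@wlen _ _))/eqP; rewrite /= oner_eq0. Qed.

Lemma letter_inj : injective (@letter G Sigma).
Proof.
move=> a b e; have h : in_seg 1%R (1%R : A) by rewrite /in_seg leAxx.
have := congr1 (fun w => wfun w 1%R) e.
by rewrite !(@wfunE (letter _) _ h).
Qed.

Lemma letter_split p q a : p * q = letter a ->
  (p = 1 /\ q = letter a) \/ (p = letter a /\ q = 1).
Proof.
have [->|/eqP/wlenN0 h] := eqVneq p 1; first by rewrite mul1g; left.
move=> e; suff q1 : q = 1 by right; rewrite -e q1 mulg1.
apply: wlen0; apply: leA_anti; last exact: wlen_ge0.
have := congr1 (@wlen _ _) e; rewrite wlenM /= => el.
by rewrite -(leA_add2l (wlen p)) el addr0.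
Qed.

Lemma last_letter w : w <> 1 -> exists s a, w = s * letter a.
Proof.
move=> /wlenN0/leA_subr_ge0 h.
exists (tab (wfun w) (wlen w - 1)%R), (wfun w (wlen w)).
rewrite -{1}[w]tab_wfun -{1}[wlen w](subrK 1%R) (tabD _ h leA01); congr (_ * _).
apply: wfun_ext; first by rewrite wlen_tab ?leA01.
move=> b; rewrite wlen_tab ?leA01 // => hb; rewrite wfun_tab ?leA01 //.
have eb : b = 1%R by case/andP: hb => h1 h2; apply: leA_anti.
have h1 : in_seg 1%R (1%R : A) by rewrite /in_seg leAxx.
by rewrite eb subrK (@wfunE (letter _) _ h1).
Qed.

Lemma letterV (a : Gam) : (letter a)^-1 = letter (barG a).
Proof. by rewrite -!finword1 finwordV. Qed.

Lemma finword_cat f f' : finword (f ++ f') = finword f * finword f'.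
Proof. by rewrite /finword big_cat. Qed.

Lemma piG_cat f f' : piG (f ++ f') = piG f * piG f'.
Proof. by rewrite /piG big_cat. Qed.

Lemma finword_cons a f : finword (a :: f) = letter a * finword f.
Proof. by rewrite /finword big_cons. Qed.

Lemma finword_nil : finword [::] = 1 :> W.
Proof. by rewrite /finword big_nil. Qed.

Lemma piG_cons (a : Gam) f : piG (a :: f) = sval a * piG f.
Proof. by rewrite /piG big_cons. Qed.

Lemma piG_nil : piG ([::] : seq Gam) = 1.
Proof. by rewrite /piG big_nil. Qed.

Lemma reduced_l p q : G_reduced (p * q) -> G_reduced p.
Proof. by move=> h p' q' f e; apply: (h p' (q' * q)); rewrite e !mulgA. Qed.

Lemma reduced_r p q : G_reduced (p * q) -> G_reduced q.
Proof. by move=> h p' q' f e; apply: (h (p * p') q'); rewrite e !mulgA. Qed.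

Lemma reduced1 : G_reduced (1 : W).
Proof.
move=> p q [//|a f] /esym/mulw1[/mulw1[_]]; rewrite finword_cons.
by case/mulw1 => /letter_neq1.
Qed.

(** The innermost two letters of a nonempty fold s s^-1 are a a^-1, a finite
    factor that is trivial in G. *)
Lemma reduced_fold s : G_reduced (s * s^-1) -> s = 1.
Proof.
move=> h; have [//|/eqP/last_letter[s' [a e]]] := eqVneq s 1.
case: (h s' s'^-1 [:: a; barG a]) => //.
  by rewrite e invgM letterV !finword_cons finword_nil mulg1 !mulgA.
by rewrite !piG_cons piG_nil mulg1 /= mulgV.
Qed.

(** * Evaluation of words by finite non-crossing cancellation *)

(** [eval w g] holds when w equals g in M(A, G) for a reason in which nothing
    is ever inserted: a derivation only cuts w into factors. *)
Inductive eval : W -> G -> Prop :=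
| eval_nil : eval 1 1
| eval_letter a : eval (letter a) (sval a)
| eval_mul w w' g g' : eval w g -> eval w' g' -> eval (w * w') (g * g')
| eval_conj u w : G_reduced u -> eval w 1 -> eval (u * w * u^-1) 1.

Lemma eval_mul1 w w' g : eval w 1 -> eval w' g -> eval (w * w') g.
Proof. by move=> h /(eval_mul h); rewrite mul1g. Qed.

Lemma eval_eq w g g' : g = g' -> eval w g -> eval w g'.
Proof. by move=> ->. Qed.

Lemma eval_fin f : eval (finword f) (piG f).
Proof.
elim: f => [|a f IH]; first by rewrite finword_nil piG_nil; apply: eval_nil.
by rewrite finword_cons piG_cons; apply: eval_mul => //; apply: eval_letter.
Qed.

Lemma reduced_finword_nil f : G_reduced (finword f) -> piG f = 1 -> f = [::].
Proof.
move=> h e; case: f e h => // a f e h.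
by case: (h 1 1 (a :: f)) => //; rewrite mulg1 mul1g.
Qed.

(** In a derivation, u w u^-1 reduced forces first w and then u to be empty,
    so that only letters and products remain. *)
Lemma eval_reduced w g : eval w g -> G_reduced w ->
  exists2 f, w = finword f & piG f = g.
Proof.
elim=> {w g} [|a|w w' g g' _ IH _ IH' h|u w _ _ IH h].
- by exists [::]; rewrite ?finword_nil ?piG_nil.
- by exists [:: a]; rewrite ?finword1 // piG_cons piG_nil mulg1.
- have [f -> <-] := IH (reduced_l h); have [f' -> <-] := IH' (reduced_r h).
  by exists (f ++ f'); rewrite ?finword_cat ?piG_cat.
- have h' := reduced_r (reduced_l h); have [f e ef] := IH h'.
  rewrite e in h'; rewrite (reduced_finword_nil h' ef) finword_nil in e.
  rewrite e mulg1 in h *; rewrite (reduced_fold h).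
  by exists [::]; rewrite ?finword_nil ?piG_nil // mul1g invg1.
Qed.

Lemma eval_reduced1 w : eval w 1 -> G_reduced w -> w = 1.
Proof.
move=> h hw; have [f e ef] := eval_reduced h hw.
by rewrite e in hw *; rewrite (reduced_finword_nil hw ef) finword_nil.
Qed.

Lemma eval_nilE g : eval 1 g -> g = 1.
Proof.
move=> /eval_reduced/(_ reduced1) [[|a f] e <-]; first by rewrite piG_nil.
by move: e; rewrite finword_cons => /esym/mulw1[/letter_neq1].
Qed.

(** Values lie in the subgroup generated by the letters, hence are represented
    by finite words. *)
Lemma eval_value w g : eval w g -> exists f, piG f = g.
Proof.
elim=> {w g} [|a|w w' g g' _ [f <-] _ [f' <-]|u w _ _ _].
- by exists [::]; rewrite piG_nil.
- by exists [:: a]; rewrite piG_cons piG_nil mulg1.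
- by exists (f ++ f'); rewrite piG_cat.
- by exists [::]; rewrite piG_nil.
Qed.

Lemma eval_valueV w g : eval w g -> exists f, piG f = g^-1.
Proof. by move=> /eval_value[f <-]; exists (rev (map (@barG _ _) f)); rewrite piGV. Qed.

Lemma eval_conjV u w : G_reduced u -> eval w 1 -> eval (u^-1 * w * u) 1.
Proof. by move=> /G_reducedV h /(eval_conj h); rewrite invgK. Qed.

(** Either the last letter is a factor of its own in the derivation, or it
    belongs to some u^-1, and then moving it to the other side turns the
    conjugation into a product with the letter a^-1. *)
Lemma eval_strip_last p a g : eval (p * letter a) g -> eval p (g * (sval a)^-1).
Proof.
move E: (p * letter a) => P H; elim: H p E => {P g}.
- by move=> p /mulw1[_ /letter_neq1].
- move=> b p /letter_split[[-> /letter_inj ->]|[_ /letter_neq1//]].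
  by rewrite mulgV; apply: eval_nil.
- move=> w w' g g' hw IH hw' IH' p /levi[[s [e1 e2]]|[s [-> e]]].
    case/esym/letter_split: e2 => -[es ew'].
      rewrite es mulg1 in e1; rewrite -e1 -[w]mulg1 -mulgA; apply: eval_mul => //.
      by apply: IH'; rewrite mul1g ew'.
    rewrite ew' in hw'; rewrite (eval_nilE hw') mulg1; apply: IH.
    by rewrite e1 es.
  by rewrite -mulgA; apply: eval_mul => //; apply: IH'.
- move=> v w hv hw IH p /levi[[s [e1 e2]]|[s [-> e]]]; rewrite mul1g.
    case/esym/letter_split: e2 => -[es ev].
      rewrite es mulg1 in e1; rewrite -e1.
      rewrite -[v]invgK ev letterV -[(sval a)^-1]mulg1.
      by apply: eval_mul => //; apply: eval_letter.
    have v1 : v = 1 by rewrite -[v]invgK ev invg1.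
    rewrite -[(sval a)^-1]mul1g; apply: IH.
    by rewrite -es -e1 v1 mul1g.
  have ev : v = letter (barG a) * s^-1 by rewrite -[v]invgK e invgM letterV.
  rewrite ev -!mulgA -[(sval a)^-1]mulg1; apply: eval_mul.
    exact: eval_letter.
  rewrite mulgA; apply: eval_conjV => //; rewrite -[s]invgK; apply: G_reducedV.
  by move: hv; rewrite ev => /reduced_r.
Qed.

Lemma eval_strip p f g : eval (p * finword f) g -> eval p (g * (piG f)^-1).
Proof.
elim/last_ind: f g => [|f a IH] g.
  by rewrite finword_nil piG_nil invg1 !mulg1.
rewrite -cats1 finword_cat piG_cat finword1 piG_cons piG_nil mulg1 mulgA.
by move/eval_strip_last/IH; rewrite invgM mulgA.
Qed.

(** Cyclic rotation, with an auxiliary word k that carries the inverse value.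
    The presence of k makes the induction go through: when the product rule
    splits the word at another place than between n and m, the part cut off is
    absorbed into k. *)
Lemma eval_rot_with n m k g : eval (n * m) g -> eval k g^-1 -> eval (m * k * n) 1.
Proof.
move E: (n * m) => P H; elim: H n m k E => {P g}.
- by move=> n m k /mulw1[-> ->]; rewrite mul1g mulg1 invg1.
- move=> a n m k /letter_split[[-> ->]|[-> ->]] hk.
    by rewrite mulg1 -(mulgV (sval a)); apply: eval_mul => //; apply: eval_letter.
  by rewrite mul1g -(mulVg (sval a)); apply: eval_mul => //; apply: eval_letter.
- move=> w w' g g' hw IH hw' IH' n m k /levi[[s [e ->]]|[s [-> e]]] hk.
    rewrite -(mulgA s); apply: IH; first exact/esym.
    by apply: eval_eq (eval_mul hw' hk); rewrite invgM mulVKg.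
  rewrite mulgA -(mulgA m); apply: IH'; first exact/esym.
  by apply: eval_eq (eval_mul hk hw); rewrite invgM mulgVK.
move=> v w hv hw IH n m k /levi[[s [e es']]|[s [-> e]]] hk; rewrite invg1 in hk.
  case: (levi e) => [[t [-> e']]|[t [ev es]]].
    have -> : m * k * (v * t) = s * (v^-1 * k * v) * t by rewrite es' !mulgA.
    by apply: IH; [apply/esym|rewrite invg1; apply: eval_conjV].
  have hn : G_reduced n by apply: (@reduced_l n t); rewrite -ev.
  have ht : G_reduced t by apply: (@reduced_r n t); rewrite -ev.
  have -> : m * k * n = (t * w * t^-1) * (n^-1 * k * n).
    by rewrite es' ev es invgM !mulgA.
  by apply: eval_mul1; [apply: eval_conj|apply: eval_conjV].
have ev : v = m^-1 * s^-1 by rewrite -[v]invgK e invgM.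
have -> : m * k * (v * w * s) = m * k * m^-1 * (s^-1 * w * s).
  by rewrite ev !mulgA.
apply: eval_mul1.
  apply: eval_conj => //; rewrite -[m]invgK.
  by apply/G_reducedV/(@reduced_l _ s^-1); rewrite -ev.
apply: eval_conjV => //; rewrite -[s]invgK; apply/G_reducedV/(@reduced_r m^-1).
by rewrite -ev.
Qed.

Lemma eval_rot n m : eval (n * m) 1 -> eval (m * n) 1.
Proof.
move/eval_rot_with/(_ (_ : eval 1 1^-1)); rewrite mulg1; apply.
by rewrite invg1; apply: eval_nil.
Qed.

(** It reduces statements about arbitrary values to the value 1. *)
Lemma eval_of_eval1 w g : (forall f, piG f = g^-1 -> eval (w * finword f) 1) ->
  (exists f : seq Gam, piG f = g^-1) -> eval w g.
Proof. by move=> h [f e]; have := eval_strip (h f e); rewrite e invgK mul1g. Qed.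

(** Rotating twice brings the place of insertion to the point where
    [eval_rot_with] may put a trivial word. *)
Lemma eval_insert p q n g : eval (p * q) g -> eval n 1 -> eval (p * n * q) g.
Proof.
move=> h hn; apply: eval_of_eval1 (eval_valueV h) => f ef.
rewrite -mulgA; apply: (@eval_rot_with _ _ _ 1); last by rewrite invg1.
apply: eval_rot; rewrite mulgA -(mulgV g); apply: eval_mul => //.
by rewrite -ef; apply: eval_fin.
Qed.

Lemma eval_strip_first a q g : eval (letter a * q) g -> eval q ((sval a)^-1 * g).
Proof.
move=> h; have [f ef] := eval_valueV h.
have : eval (letter a * q * finword f) 1.
  by rewrite -(mulgV g); apply: eval_mul => //; rewrite -ef; apply: eval_fin.
rewrite -mulgA => /eval_rot/eval_strip_last/eval_strip.
by rewrite ef invgK mul1g.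
Qed.

(** A matching of u with something in p and a matching of u^-1 with something
    in q compose to a matching of these two parts. In the product case the
    parts of u are removed one after the other; in the conjugation case either
    u is swallowed by v^-1, and the conclusion is an insertion, or u ends with
    v^-1, and this part is rotated away. *)
Lemma eval_join p u q g g' : eval (p * u) g -> G_reduced u -> eval (u^-1 * q) g' ->
  eval (p * q) (g * g').
Proof.
move E: (p * u) => P H; elim: H p u q g' E => {P g}.
- by move=> p u q g' /mulw1[-> ->] _; rewrite invg1 !mul1g.
- move=> a p u q g' /letter_split[[-> ->]|[-> ->]] _.
    by rewrite letterV mul1g => /eval_strip_first /=; rewrite invgK.
  by rewrite invg1 mul1g; apply: eval_mul; apply: eval_letter.
- move=> w w' g1 g2 hw IH hw' IH' p u q g' /levi[[s [e ->]]|[s [-> e]]] hu.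
    rewrite invgM -!mulgA => h; apply: IH (esym e) (reduced_l hu) _.
    by rewrite -[s^-1 * q]mul1g; apply: IH' h; rewrite ?mul1g //; apply: reduced_r hu.
  by move=> h; rewrite -!mulgA; apply: eval_mul => //; apply: IH' h.
move=> v w hv hw IH p u q g' /levi[[s [e1 e2]]|[s [-> e]]] hu; rewrite mul1g.
  case: (levi e1) => [[t [-> e]]|[t [ev es]]].
    rewrite e2 invgM invgK => h; apply: eval_of_eval1 (eval_valueV h) => f ef.
    have : eval (v * s^-1 * q * finword f) 1.
      by rewrite -(mulgV g'); apply: eval_mul => //; rewrite -ef; apply: eval_fin.
    rewrite -!mulgA => /eval_rot; rewrite -!mulgA.
    have hs : G_reduced s by move: hu; rewrite e2 => /reduced_l.
    move=> /(IH t s _ _ (esym e) hs); rewrite mul1g => h'.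
    by apply: eval_rot; rewrite -!mulgA.
  (* Here u ends with w v^-1, so w is reduced and thus empty; then u = p^-1. *)
  have w1 : w = 1.
    by apply: eval_reduced1 hw _; move: hu; rewrite e2 es => /reduced_l/reduced_r.
  have t1 : t = 1.
    apply: reduced_fold; apply: (@reduced_l _ p^-1).
    by move: hu; rewrite e2 es w1 mulg1 ev invgM mulgA.
  by rewrite e2 es w1 ev t1 !mulg1 mul1g invgK.
have ev : v = u^-1 * s^-1 by rewrite -[v]invgK e invgM.
move=> h; have -> : v * w * s = u^-1 * (s^-1 * w * s) by rewrite ev !mulgA.
apply: eval_insert h _; apply: eval_conjV => //.
by rewrite -[s]invgK; apply/G_reducedV/(@reduced_r u^-1); rewrite -ev.
Qed.

Lemma reduced_fold_mid p s q : G_reduced (p * s * s^-1 * q) -> s = 1.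
Proof. by rewrite -(mulgA p) => /reduced_l/reduced_r/reduced_fold. Qed.

(** The centre of a nonempty fold u u^-1 cannot lie strictly inside the
    reduced words v or v^-1, as these would then contain a fold; so it lies in
    w or on its boundary. *)
Lemma conj_center v w p u q :
  v * w * v^-1 = p * u * (u^-1 * q) -> G_reduced v -> u <> 1 ->
  exists s s', [/\ w = s * s', p * u = v * s & u^-1 * q = s' * v^-1].
Proof.
move=> e hv u1; have hv' := G_reducedV hv.
case: (levi e) => [[s [e1 e2]]|[s [e1 e2]]].
  case: (levi e1) => [[t [e3 e4]]|[t [e3 e4]]]; last first.
    case: u1; apply: (@reduced_fold_mid t _ q); rewrite -mulgA -e4; by rewrite -e2.
  have s1 : s = 1.
    apply: (@reduced_fold_mid 1 _ (t^-1 * q)).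
    have -> : 1 * s * s^-1 * (t^-1 * q) = s * (u^-1 * q).
      by rewrite e4 invgM mul1g !mulgA.
    by rewrite -e2.
  exists w, 1; rewrite mulg1 mul1g; split=> //; first by rewrite e1 s1 mulg1.
  by rewrite e2 s1 mul1g.
case: (levi e1) => [[t [e3 e4]]|[t [e3 e4]]]; last first.
  have e5 : u^-1 * q = t * (w * v^-1) by rewrite e2 e4 mulgA.
  case: (levi e5) => [[r [e6 e7]]|[r [e6 e7]]].
    by case: u1; apply: (@reduced_fold_mid p _ r); rewrite -mulgA -e6 -e3.
  have t1 : t^-1 = 1.
    apply: (@reduced_fold_mid (p * r^-1) _ 1); rewrite mulg1 invgK -(mulgA p).
    by rewrite -invgM -e6 invgK -e3.
  rewrite -[t]invgK t1 invg1 in e3 e4 *; exists 1, w.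
  by rewrite mul1g e3 !mulg1; split=> //; rewrite -[p * u]mulg1 -e3 e2 e4 mul1g.
by exists t, s; split.
Qed.

(** If the derivation cuts the fold u u^-1 into two factors, the shorter fold
    left in one of them is deleted by induction and the remaining part of u
    joins the two factors by [eval_join]. In a conjugation v w v^-1 the centre
    lies in w and the four cases tell which of the two ends of the fold stick
    out of w. *)
Lemma eval_cancel p u q g :
  eval (p * u * (u^-1 * q)) g -> G_reduced u -> eval (p * q) g.
Proof.
move E: (p * u * (u^-1 * q)) => P H; elim: H p u q E => {P g}.
- by move=> p u q /mulw1[/mulw1[-> _] /mulw1[_ ->]] _; rewrite mulg1; apply: eval_nil.
- move=> a p u q /letter_split[[/mulw1[-> u1] e]|[e /mulw1[u1 ->]]] _.
    by rewrite u1 invg1 mul1g in e; rewrite mul1g e; apply: eval_letter.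
  by rewrite -[u]invgK u1 invg1 mulg1 in e; rewrite e mulg1; apply: eval_letter.
- move=> w w' g1 g2 hw IH hw' IH' p u q /levi[[s [e1 e2]]|[s [e1 e2]]] hu; last first.
    case: (levi e1) => [[t [e3 e4]]|[t [e3 e4]]].
      rewrite e4 invgM in e2 hu.
      have h2 : eval (t^-1 * q) g2.
        rewrite -[t^-1 * q]mul1g; apply: (IH' _ s) (reduced_r hu).
        by rewrite mul1g e2 !mulgA.
      by apply: (@eval_join _ t) (reduced_l hu) h2; rewrite -e3.
    rewrite e3 -mulgA; apply: eval_mul => //; apply: (IH' _ u) => //.
    by rewrite e2 e4.
  case: (levi e2) => [[t [e3 e4]]|[t [e3 e4]]].
    rewrite e4 mulgA; apply: eval_mul => //; apply: (IH _ u) => //.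
    by rewrite -e3 e1.
  have eu : u = t^-1 * s^-1 by rewrite -[u]invgK e3 invgM.
  rewrite eu in hu; apply: (@eval_join _ t^-1); last by rewrite invgK -e4.
    rewrite -[p * t^-1]mulg1; apply: (IH _ s^-1) (reduced_r hu).
    by rewrite e1 eu invgK mulg1 !mulgA.
  exact: reduced_l hu.
move=> v w hv hw IH p u q e hu.
have [u1|u1] := pselect (u = 1).
  by move: e; rewrite u1 invg1 mulg1 mul1g => ->; apply: eval_conj.
case: (conj_center (esym e) hv u1) => s [s' [ew /esym e1 /esym e2]].
have hv' := G_reducedV hv.
case: (levi e1) => [[p' [e3 e4]]|[u' [e3 e4]]];
  case: (levi e2) => [[t [e5 e6]]|[q' [e5 e6]]].
- have eu : u = t^-1 * s'^-1 by rewrite -[u]invgK e5 invgM.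
  have h : eval (p' * t^-1) 1.
    rewrite -[p' * _]mulg1; apply: (IH _ s'^-1).
      by rewrite ew e4 eu invgK mulg1 !mulgA.
    by move: hu; rewrite eu => /reduced_r.
  have ev : v = q^-1 * t^-1 by rewrite -[v]invgK e6 invgM.
  have -> : p * q = q^-1 * (t^-1 * p') * q by rewrite e3 ev mulgA.
  apply: eval_conjV (eval_rot h); rewrite -[q]invgK; apply: G_reducedV.
  by move: hv; rewrite ev => /reduced_l.
- have -> : p * q = v * (p' * q') * v^-1 by rewrite e3 e6 !mulgA.
  apply: eval_conj => //; apply: (IH _ u) => //.
  by rewrite ew e4 e5.
- have eu : u = t^-1 * s'^-1 by rewrite -[u]invgK e5 invgM.
  have ev : v = q^-1 * t^-1 by rewrite -[v]invgK e6 invgM.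
  (* Both ends of the fold stick out of w: it suffices that they are equal,
     and their difference r is reduced and evaluates to 1. *)
  suff et : t^-1 = u'.
    rewrite e3 et in ev; rewrite (mulIw ev) -[q^-1]mulg1.
    apply: eval_conjV; last exact: eval_nil.
    by apply: (@reduced_r t); rewrite -e6.
  rewrite e4 in eu; case: (levi eu) => [[r [e7 e8]]|[r [e7 e8]]].
    have r1 : r = 1; last by rewrite e7 r1 mulg1.
    apply: eval_reduced1; last by move: hu; rewrite e4 e8 => /reduced_r/reduced_l.
    rewrite -[r]mulg1; apply: (IH _ s'^-1); last first.
      by move: hu; rewrite e4 e8 => /reduced_r/reduced_r.
    by rewrite ew e8 invgK mulg1.
  have r1 : r^-1 = 1; last by rewrite e7 -[r]invgK r1 invg1 mulg1.
  have es' : s' = s^-1 * r^-1 by rewrite -[s']invgK e8 invgM.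
  apply: eval_reduced1; last first.
    by apply: G_reducedV; move: hu; rewrite e4 e7 => /reduced_l/reduced_r.
  rewrite -[r^-1]mul1g; apply: (IH _ s); last by move: hu; rewrite e4 => /reduced_r.
  by rewrite ew es' mul1g.
- have h : eval (u'^-1 * q') 1.
    rewrite -[_ * _]mul1g; apply: (IH _ s); last by move: hu; rewrite e4 => /reduced_r.
    by rewrite ew e5 e4 invgM mul1g !mulgA.
  have -> : p * q = p * (q' * u'^-1) * p^-1 by rewrite e6 e3 invgM !mulgA.
  by apply: eval_conj (eval_rot h); move: hv; rewrite e3 => /reduced_l.
Qed.

Lemma eval_relator u (l r : seq Gam) : G_reduced u -> piG l = piG r ->
  eval (u * finword l * (finword r)^-1 * u^-1) 1.
Proof.
move=> hu e; rewrite -(mulgA u); apply: eval_conj => //.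
by rewrite finwordV -(mulgV (piG l)) {2}e -piGV; apply: eval_mul; apply: eval_fin.
Qed.

(** Evaluability in every context is preserved by the relators, hence by the
    congruence that they generate. *)
Lemma eval_Mcong u v : Mcong u v ->
  forall p q, eval (p * u * q) 1 <-> eval (p * v * q) 1.
Proof.
elim=> {u v} [u l r hu e|u|u v _ IH|u v w _ IH _ IH'|u u' v v' _ IH _ IH'] p q.
- rewrite mulg1; split=> h; last by apply: eval_insert => //; apply: eval_relator.
  apply: (@eval_cancel _ u) => //; apply: eval_rot.
  have : eval (u^-1 * q * (p * u) * (finword l * (finword r)^-1)) 1.
    by rewrite -(mulgA (_ * q)); apply: eval_rot; move: h; rewrite !mulgA.
  rewrite finwordV -finword_cat => /eval_strip.
  by rewrite piG_cat piGV e mulgV invg1 mulg1.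
- by [].
- by split=> /IH.
- by rewrite IH IH'.
- by rewrite mulgA -(mulgA (p * u)) IH mulgA -(mulgA p) mulgA IH' -!mulgA.
Qed.

Lemma reduced_Mcong1 w : G_reduced w -> Mcong w 1 -> w = 1.
Proof.
move=> hw /eval_Mcong/(_ 1 1); rewrite !mulg1 mul1g => -[_ h].
by apply: eval_reduced1 (h (@eval_nil)) hw.
Qed.

End Words.

(** * Residues modulo the lattice of periods *)

Section Residue.
Variables (al : A) (al_ge1 : leA 1%R al).

Let al_ge0 : leA 0%R al. Proof. exact: leA_trans leA01 al_ge1. Qed.

Let lead_al : (0 < lead_coef al)%R.
Proof.
move: al_ge0; rewrite /leA subr0 => /orP[/eqP e|//].
by move: al_ge1; rewrite -e => /(leA_anti leA01)/eqP; rewrite eq_sym oner_eq0.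
Qed.

Let size_al : size al = (size al).-1.+1.
Proof. by rewrite prednK // size_poly_gt0 -lead_coef_eq0 gt_eqF. Qed.

(** Division of the coefficient in degree deg al brings it between 0 and the
    leading coefficient of al. The result is below al; if it is not positive,
    it becomes so after adding al once more. *)
Lemma residue_exists (y : A) : (size y <= size al)%N ->
  exists k : int, in_seg al (y - k *: al)%R.
Proof.
move=> hy; set d := (size al).-1; set c := lead_coef al.
have cE : c = (al`_d)%R by [].
set k := (y`_d %/ c)%Z; set y' := (y - k *: al)%R.
have sy' : (size y' <= d.+1)%N.
  by rewrite -size_al (leq_trans (size_polyD _ _)) // geq_max hy size_polyN size_scale_leq.
have e : (y'`_d = (y`_d %% c)%Z)%R.
  by rewrite coefB coefZ -cE /k {1}(divz_eq (y`_d)%R c) addrAC subrr add0r.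
have r0 : (0 <= y'`_d)%R by rewrite e modz_ge0 // gt_eqF.
have rc : (y'`_d < c)%R by rewrite e ltz_pmod.
have [h1|/ltA_add1 h1] := boolP (leA 1%R y').
  exists k; rewrite /in_seg h1 leA_subr.
  apply: (proj1 (@leA_gt0_coef d _ _ _)); last by rewrite coefB -cE subr_gt0.
  by rewrite (leq_trans (size_polyD _ _)) // geq_max size_polyN sy' -size_al leqnn.
have h0 : leA y' 0%R.
  by rewrite -(leA_add2l 1%R) addr0 addrC.
exists (k - 1)%R; have -> : (y - (k - 1) *: al = al + y')%R.
  by rewrite scalerBl scale1r opprB addrCA.
apply/andP; split; last by rewrite -{2}[al]addr0 leA_add2l.
have [] := @leA_gt0_coef d (al + y')%R; last exact: leA_ge1.
  by rewrite (leq_trans (size_polyD _ _)) // geq_max sy' -size_al leqnn.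
by rewrite coefD -cE ltr_pwDl.
Qed.

Lemma residue_shift0 (y : A) (k : int) : in_seg al y -> in_seg al (y + k *: al)%R ->
  k = 0%R.
Proof.
have shift n z : in_seg al z -> in_seg al (z + al *+ n)%R -> n = 0%N.
  case: n => // n /andP[h1 _] /andP[_ h2].
  have h : leA (al + 1)%R al.
    apply: leA_trans h2; rewrite mulrS addrCA leA_add2l.
    by apply: (leA_trans h1); apply/leA_addr/leA_muln.
  have := leA_anti h (leA_addr al leA01).
  by rewrite -{2}[al]addr0 => /addrI/eqP; rewrite oner_eq0.
case: k => n hy.
  by rewrite -[Posz n]intz scaler_int -pmulrn => /(shift _ _ hy) ->.
rewrite NegzE -[X in (X *: _)%R]intz scaler_int mulrNz -pmulrn => h.
have := shift n.+1 _ h; by rewrite subrK => /(_ hy).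
Qed.

(** The group of periods, spanned by al and the powers t^d with d > deg al. *)
Definition lattice (l : A) : Prop :=
  exists k : int, take_poly (size al) l = (k *: al)%R.

Lemma latticeD l l' : lattice l -> lattice l' -> lattice (l + l')%R.
Proof. by case=> k e [k' e']; exists (k + k')%R; rewrite take_polyD e e' scalerDl. Qed.

Lemma latticeN l : lattice l -> lattice (- l)%R.
Proof. by case=> k e; exists (- k)%R; rewrite -scaleN1r take_polyZ e scalerA mulN1r. Qed.

Lemma lattice0 : lattice 0%R.
Proof. by exists 0%R; rewrite take_poly0r scale0r. Qed.

Lemma lattice_al : lattice al.
Proof. by exists 1%R; rewrite take_poly_id // scale1r. Qed.

Definition is_residue (g r : A) : Prop := in_seg al r /\ lattice (g - r)%R.

Lemma in_seg_size r : in_seg al r -> (size r <= size al)%N.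
Proof. by case/andP=> h1 h2; apply: leA_size h2; apply: leA_trans leA01 h1. Qed.

Lemma ex_residue g : exists r, is_residue g r.
Proof.
have [k hk] := @residue_exists (take_poly (size al) g) (size_take_poly _ _).
exists (take_poly (size al) g - k *: al)%R; split=> //; exists k.
by rewrite take_polyB (take_poly_id (in_seg_size hk)) opprB addrC subrK.
Qed.

Definition residue g : A := xget 0%R (is_residue g).

Lemma residueP g : is_residue g (residue g).
Proof. by have [r hr] := ex_residue g; apply: (xgetI 0%R hr). Qed.

Lemma residue_eq g r : is_residue g r -> residue g = r.
Proof.
case: (residueP g); set s := residue g => hs ls [hr lr].
have [k] : lattice (s - r)%R.
  have -> : (s - r = (g - r) - (g - s))%R by rewrite opprB [RHS]addrC subrKA.
  by apply: latticeD => //; apply: latticeN.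
rewrite take_poly_id => [e|]; last first.
  by rewrite (leq_trans (size_polyD _ _)) // geq_max size_polyN !in_seg_size.
have k0 : k = 0%R by apply: (residue_shift0 hr); rewrite -e addrC subrK.
by apply/eqP; rewrite -subr_eq0 e k0 scale0r.
Qed.

Lemma residueD l g : lattice l -> residue (l + g)%R = residue g.
Proof.
move=> hl; have [h1 h2] := residueP g; apply: residue_eq; split=> //.
by rewrite -addrA; apply: latticeD.
Qed.

Lemma residue_id g : in_seg al g -> residue g = g.
Proof. by move=> h; apply: residue_eq; split; rewrite // subrr; apply: lattice0. Qed.

End Residue.

(** * The periodic words and the embedding of Z[t] *)

Section Periodic.
Variables (G : groupType) (Sigma : set G) (a0 : Gamma Sigma) (x : word Sigma).
Hypotheses (x_neq1 : x <> 1) (x_cyc : cyclically_G_reduced x).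
Local Notation al := (wlen x).
Local Notation wfun := (wfun a0).

Let al_ge1 : leA 1%R al. Proof. exact: wlenN0. Qed.
Let al_ge0 : leA 0%R al. Proof. exact: wlen_ge0. Qed.
Local Notation lattice := (lattice al).

Definition periodic (g : A) : Gamma Sigma := wfun x (residue al g).

Lemma periodicD l g : lattice l -> periodic (l + g)%R = periodic g.
Proof. by move=> h; rewrite /periodic residueD. Qed.

Lemma tab_periodicD l L : lattice l -> leA 0%R l -> leA 0%R L ->
  tab periodic (l + L)%R = tab periodic l * tab periodic L.
Proof.
move=> h hl hL; rewrite tabD //; congr (_ * _).
by apply: eq_tab => b _; rewrite periodicD.
Qed.

Lemma tab_periodic_len : tab periodic al = x.
Proof.
rewrite -[RHS](tab_wfun a0); apply: eq_tab => b hb.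
by rewrite /periodic residue_id.
Qed.

Lemma tab0 (F : A -> Gamma Sigma) : tab F 0%R = 1.
Proof. by apply: (wlen0 a0); rewrite wlen_tab // leAxx. Qed.

Lemma tab_periodic_muln n : tab periodic (al *+ n)%R = x ^+ n.
Proof.
elim: n => [|n IH]; first by rewrite mulr0n tab0.
rewrite mulrS expgS tab_periodicD ?IH ?tab_periodic_len //; first exact: lattice_al.
exact: leA_muln.
Qed.

Lemma wlen_fin (f : seq (Gamma Sigma)) : wlen (finword f) = (1 *+ size f)%R.
Proof.
elim: f => [|a f IH]; first by rewrite finword_nil.
by rewrite finword_cons wlenM IH mulrS.
Qed.

(** A finite factor starting at position |p| is the same as the one starting
    at the residue y of |p|, and this one lies in a power of x since y <= al
    and al >= 1. *)
Lemma tab_periodic_reduced L : G_reduced (tab periodic L).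
Proof.
have [hL|hL] := boolP (leA 0%R L); last first.
  suff -> : tab periodic L = 1 by apply: reduced1.
  by apply: (wlen0 a0); rewrite /= /nneg (negbTE hL).
move=> p q f e f0; set F := finword f in e; set a := wlen p.
have [hy hl] := residueP al_ge1 a; set y := residue al a in hy hl.
have y0 : leA 0%R y by case/andP: hy => h _; apply: leA_trans leA01 h.
have eF : F = tab (fun b => periodic (y + b)%R) (wlen F).
  rewrite -{1}[F](tab_wfun a0); apply: eq_tab => b hb.
  rewrite -(periodicD (y + b)%R hl) addrA subrK -(wfun_catr a0 p hb).
  have hpb : in_seg (wlen (p * F)) (a + b)%R.
    case/andP: hb => h1 h2; apply/andP; split; last by rewrite wlenM leA_add2l.
    by apply: (leA_trans h1); apply/leA_addl/wlen_ge0.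
  rewrite -(wfun_catl a0 q hpb) -e wfun_tab //.
  by rewrite -(wlen_tab periodic hL) e; apply: in_segl hpb; apply: wlen_ge0.
(* The position y + n is at most (n + 1) al, so n + 1 copies of x suffice. *)
set n := size f.
have hr : leA 0%R (al *+ n.+1 - (y + wlen F))%R.
  rewrite wlen_fin -/n mulrS opprD addrACA -mulrnBl.
  apply: leA_add0; first by rewrite -leA_subr; case/andP: hy.
  by apply: leA_muln; rewrite -leA_subr.
apply: (x_cyc (k := n.+1) (p := tab periodic y)
  (q := tab (fun b => periodic (y + wlen F + b)%R)
    (al *+ n.+1 - (y + wlen F))%R)) => //.
rewrite -tab_periodic_muln -/F {1}eF.
rewrite -[X in tab periodic X](subrK (y + wlen F)%R) [X in tab periodic X]addrC.
by rewrite (tabD a0 _ (leA_add0 y0 (wlen_ge0 F)) hr) (tabD a0 _ y0 (wlen_ge0 F)).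
Qed.

Definition lat_class (l : A) : E Sigma.
Proof.
exists (Mclass (tab periodic l)); apply/asboolP; exists (tab periodic l) => //.
exists [:: tab periodic l]; last by rewrite big_seq1.
by move=> u; rewrite inE => /eqP ->; apply: tab_periodic_reduced.
Defined.

Lemma lat_classD l L : lattice l -> leA 0%R l -> leA 0%R L ->
  lat_class (l + L)%R = lat_class l * lat_class L.
Proof. by move=> h hl hL; apply/val_inj; rewrite valM /= -MclassM tab_periodicD. Qed.

Lemma lat_class0 : lat_class 0%R = 1.
Proof. by apply/val_inj; rewrite val1 /= tab0. Qed.

Lemma lat_class_inj1 l : leA 0%R l -> lat_class l = 1 -> l = 0%R.
Proof.
move=> hl /(congr1 val); rewrite val1 /= => /MclassP.
move/(reduced_Mcong1 a0 (@tab_periodic_reduced _)).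
by move/(congr1 (@wlen _ _)); rewrite wlen_tab.
Qed.

Lemma nnegB (l : A) : (nneg l - nneg (- l) = l)%R.
Proof.
rewrite /nneg; case: ifP => h; case: ifP => h'; rewrite ?sub0r ?opprK ?subr0 //.
  have l0 : l = 0%R; last by rewrite l0 addr0.
  by apply: leA_anti => //; rewrite leA_subr sub0r.
have := leA_total 0%R l; by rewrite h /= leA_subr sub0r h'.
Qed.

Lemma lattice_nneg l : lattice l -> lattice (nneg l).
Proof. by rewrite /nneg; case: ifP => // _ _; apply: lattice0. Qed.

(** The extension of [lat_class] to negative lattice elements, as a difference
    of its values on the positive and negative parts. *)
Definition lat_hom (l : A) : E Sigma :=
  lat_class (nneg l) * (lat_class (nneg (- l)%R))^-1.

Lemma lat_class_comm l L : lattice l -> lattice L -> leA 0%R l -> leA 0%R L ->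
  commute (lat_class l) (lat_class L).
Proof. by move=> *; rewrite /commute -!lat_classD // addrC. Qed.

(** Any expression as a difference of positive lattice elements may be used:
    two of them become equal after adding both subtrahends, as in a group of
    fractions. *)
Lemma lat_homB p q : lattice p -> lattice q -> leA 0%R p -> leA 0%R q ->
  lat_hom (p - q)%R = lat_class p * (lat_class q)^-1.
Proof.
move=> lp lq hp hq; rewrite /lat_hom; set l := (p - q)%R.
have ll : lattice l by apply: latticeD => //; apply: latticeN.
have h1 := lattice_nneg ll; have h2 := lattice_nneg (latticeN ll).
have e : (nneg l + q = nneg (- l) + p)%R.
  apply/eqP; rewrite -subr_eq0 opprD addrACA nnegB.
  by rewrite -[(q - p)%R]opprB subrr.
have := lat_classD h1 (nneg_ge0 l) hq; rewrite e lat_classD ?nneg_ge0 // => e2.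
have c : commute (lat_class p) (lat_class (nneg (- l)%R)).
  by apply: lat_class_comm => //; apply: nneg_ge0.
rewrite -c in e2.
apply: (@mulIg _ (lat_class (nneg (- l)%R))); rewrite mulgVK -mulgA.
have c' : commute (lat_class q)^-1 (lat_class (nneg (- l)%R)).
  by apply/commute_sym/commuteV; apply: lat_class_comm => //; apply: nneg_ge0.
by rewrite c' mulgA e2 mulgK.
Qed.

Lemma lat_homD l L : lattice l -> lattice L ->
  lat_hom (l + L)%R = lat_hom l * lat_hom L.
Proof.
move=> hl hL; have h1 := lattice_nneg hl; have h2 := lattice_nneg (latticeN hl).
have h3 := lattice_nneg hL; have h4 := lattice_nneg (latticeN hL).
rewrite -{1}[l]nnegB -{1}[L]nnegB addrACA -opprD lat_homB ?leA_add0 ?nneg_ge0 //;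
  try exact: latticeD.
rewrite (lat_classD h1) ?nneg_ge0 //.
rewrite [(nneg (- l) + _)%R]addrC (lat_classD h4) ?nneg_ge0 //.
rewrite invgM.
rewrite /lat_hom -!mulgA; congr (_ * _); rewrite !mulgA; congr (_ * _).
by apply/commuteV/lat_class_comm => //; apply: nneg_ge0.
Qed.

Lemma lat_hom_inj1 l : lat_hom l = 1 -> l = 0%R.
Proof.
have main z : leA 0%R z -> nneg (- z)%R = 0%R.
  rewrite /nneg; case: ifP => // h h'; apply/eqP; rewrite oppr_eq0; apply/eqP.
  by apply: leA_anti => //; rewrite leA_subr sub0r.
rewrite /lat_hom; have /orP[h|h] := leA_total 0%R l.
  by rewrite main // lat_class0 invg1 mulg1 nneg_id //; apply: lat_class_inj1.
have h' : leA 0%R (- l)%R by rewrite -sub0r -leA_subr.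
rewrite -{1}[l]opprK (main _ h') lat_class0 mul1g nneg_id // => e.
have /(lat_class_inj1 h')/eqP : lat_class (- l)%R = 1.
  by rewrite -[lat_class _]invgK e invg1.
by rewrite oppr_eq0 => /eqP.
Qed.

(** The linear map sending 1 to al and t^d to t^(deg al + d) for d > 0: the
    exponent size al is deg al + 1 and makes up for the factor t lost in
    [drop_poly 1]. *)
Definition lat_of_poly (a : A) : A :=
  (a`_0 *: al + drop_poly 1 a * 'X^(size al))%R.

Lemma take_lat_of_poly a : take_poly (size al) (lat_of_poly a) = (a`_0 *: al)%R.
Proof. by rewrite take_polyDMXn // size_scale_leq. Qed.

Lemma lat_of_polyD a b :
  lat_of_poly (a + b)%R = (lat_of_poly a + lat_of_poly b)%R.
Proof. by rewrite /lat_of_poly coefD scalerDl drop_polyD mulrDl addrACA. Qed.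

Lemma lat_of_poly_inj1 a : lat_of_poly a = 0%R -> a = 0%R.
Proof.
move=> e; have := take_lat_of_poly a; rewrite e take_poly0r => /esym/eqP.
have al0 : al != 0%R.
  by apply/eqP=> al0; apply: x_neq1; apply: (wlen0 a0).
rewrite -mul_polyC mulf_eq0 polyC_eq0 (negbTE al0) orbF => /eqP a00.
move/eqP: e; rewrite /lat_of_poly a00 scale0r add0r.
rewrite mulf_eq0 expf_eq0 polyX_eq0 andbF orbF => /eqP d0.
apply/polyP=> -[|i]; first by rewrite a00 coef0.
by have := congr1 (fun p : A => p`_i)%R d0; rewrite coef_drop_poly addn1 !coef0.
Qed.

Definition poly_emb a : E Sigma := lat_hom (lat_of_poly a).

Lemma poly_embD a b : poly_emb (a + b)%R = poly_emb a * poly_emb b.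
Proof.
rewrite /poly_emb lat_of_polyD lat_homD //; eexists; exact: take_lat_of_poly.
Qed.

Lemma poly_emb_inj1 a : poly_emb a = 1 -> a = 0%R.
Proof. by move/lat_hom_inj1/lat_of_poly_inj1. Qed.

Lemma val_poly_emb1 : val (poly_emb 1%R) = Mclass x.
Proof.
have -> : poly_emb 1%R = lat_class al; last by rewrite /= tab_periodic_len.
have -> : poly_emb 1%R = lat_hom (al - 0)%R.
  rewrite /poly_emb /lat_of_poly coef1 scale1r.
  by rewrite drop_poly_eq0 ?size_poly1 // mul0r addr0 subr0.
rewrite lat_homB ?leAxx //; first by rewrite lat_class0 invg1 mulg1.
  exact: lattice_al.
exact: lattice0.
Qed.

End Periodic.

(** * Bases from injective homomorphisms on Z[t] *)

Section Basis.
Variables (H : groupType) (hom : A -> H).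
Hypotheses (homD : forall a b, hom (a + b)%R = hom a * hom b).
Hypothesis hom_inj1 : forall a, hom a = 1 -> a = 0%R.

Let xs (i : nat) : H := hom ('X^i)%R.

Let hom0 : hom 0%R = 1.
Proof. by apply: (@mulgI _ (hom 0%R)); rewrite -homD addr0 mulg1. Qed.

Let homN a : hom (- a)%R = (hom a)^-1.
Proof. by apply: (@mulgI _ (hom a)); rewrite -homD subrr hom0 mulgV. Qed.

Lemma hom_scale a (c : int) : hom (c *: a)%R = expgz (hom a) c.
Proof.
have Pn n : hom (a *+ n)%R = hom a ^+ n.
  by elim: n => [|n IH]; rewrite ?mulr0n ?hom0 // mulrS homD IH expgS.
case: c => n /=; first by rewrite -[Posz n]intz scaler_int -pmulrn.
by rewrite NegzE -[X in (X *: _)%R]intz scaler_int mulrNz -pmulrn homN Pn.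
Qed.

Lemma hom_poly n (c : nat -> int) :
  hom (\poly_(i < n) c i)%R = \prod_(i < n) expgz (xs i) (c i).
Proof.
rewrite poly_def; elim: n => [|n IH]; first by rewrite !big_ord0.
by rewrite !big_ord_recr homD /= IH hom_scale.
Qed.

Lemma poly_hom_monomials a : poly_hom xs a = hom a.
Proof. by rewrite -[in RHS](coefK a) hom_poly. Qed.

(** Expanding a polynomial into monomials turns its value into a product of
    powers; so the monomials generate the range, and a relation between them
    is a polynomial in the kernel. *)
Lemma monomials_basis : free_abelian_basis (range hom) xs.
Proof.
have sg : subgroup (range hom).
  split; first by exists 0%R.
    by move=> _ _ [a _ <-] [b _ <-]; exists (a + b)%R.
  by move=> _ [a _ <-]; exists (- a)%R.
split=> //.
- by move=> _ _ [a _ <-] [b _ <-]; rewrite -!homD addrC.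
- apply/seteqP; split.
    by apply: smallest_sub => // _ [i _ <-]; exists ('X^i)%R.
  move=> _ [a _ <-] Y [[Y1 YM YV] hY].
  rewrite -poly_hom_monomials /poly_hom; elim/big_ind: _ => // i _.
  have hx : Y (xs i) by apply: hY; exists (nat_of_ord i).
  have hp n : Y (xs i ^+ n) by elim: n => // n IH; rewrite expgS; apply: YM.
  by case: (a`_i)%R => n //=; apply: YV.
- move=> n c; rewrite -hom_poly => /hom_inj1 e i hi.
  by have := congr1 (fun p : A => p`_i)%R e; rewrite coef_poly hi coef0.
Qed.

Lemma poly_hom_monomials_inj : injective (poly_hom xs).
Proof.
move=> a b; rewrite !poly_hom_monomials => e; apply/eqP; rewrite -subr_eq0.
by apply/eqP/hom_inj1; rewrite homD homN e mulgV.
Qed.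

End Basis.

Theorem proposition9p3 (G : groupType) (Sigma : set G)
    (Sigma_gen : smallest (@subgroup G) Sigma = setT)
    (Sigma_neq1 : forall a : G, Sigma a -> a <> 1)
    (x : word Sigma) (x_nonempty : x <> 1)
    (x_cyc : cyclically_G_reduced x) :
  exists (X : set (E Sigma)) (xs : nat -> E Sigma),
    [/\ free_abelian_basis X xs,
        val (xs 0%N) = Mclass x,
        (forall a b : {poly int},
           poly_hom xs (a + b)%R = poly_hom xs a * poly_hom xs b)
      & injective (poly_hom xs)].
Proof.
have al1 : in_seg (wlen x) 1%R.
  rewrite /in_seg leAxx /=; apply: leA_ge1; first exact: wlen_ge0.
  move=> x0; apply: x_nonempty; apply: word_ext => // b hb.
  by exfalso; move: hb; rewrite x0 in_seg0.
(* The first letter of x serves as the default letter. *)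
pose a0 := wat (exist (in_seg (wlen x)) 1%R al1).
pose P := poly_emb a0 x_nonempty x_cyc.
have PD := poly_embD a0 x_nonempty x_cyc.
have P1 := @poly_emb_inj1 _ _ a0 _ x_nonempty x_cyc.
exists (range P), (fun i => P ('X^i)%R); split.
- exact: monomials_basis.
- exact: val_poly_emb1.
- by move=> a b; rewrite !(poly_hom_monomials PD) PD.
- exact: poly_hom_monomials_inj.
Qed.
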